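(* Let $\mathfrak{A},\mathfrak{B},\mathfrak{A}',\mathfrak{B}'$ be categories, let $\mathbb{T}:\mathfrak{A}\to\mathfrak{B}$ be left adjoint to $\mathbb{H}:\mathfrak{B}\to\mathfrak{A}$ and let $\mathbb{T}':\mathfrak{A}'\to\mathfrak{B}'$ be left adjoint to $\mathbb{H}':\mathfrak{B}'\to\mathfrak{A}'$. Let $F':\mathfrak{A}\to\mathfrak{A}'$ and $F:\mathfrak{B}\to\mathfrak{B}'$ be functors such that $\mathbb{T}'\circ F'$ and $F\circ\mathbb{T}$ are naturally equivalent, and also $F'\circ\mathbb{H}$ and $\mathbb{H}'\circ F$ are naturally equivalent. Let $P$ be an object in $\mathfrak{B}$ and let $I$ be an object in $\mathfrak{A}$. Then: (a) If $P$ is $\mathcal{E}_{\mathbb{H}}$-projective, then $F(P)$ is $\mathcal{E}_{\mathbb{H}'}$-projective; the converse is true whenever $F$ is separable. (a$^{op}$) If $I$ is $\mathcal{I}_{\mathbb{T}}$-injective, then $F'(I)$ is $\mathcal{I}_{\mathbb{T}'}$-injective; the converse is true whenever $F'$ is separable.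
   Context: For a functor $\mathbb{H}:\mathfrak{B}\to\mathfrak{A}$, $\mathcal{E}_{\mathbb{H}}$ is the class of morphisms $f$ of $\mathfrak{B}$ such that $\mathbb{H}(f)$ has a section (right inverse) in $\mathfrak{A}$. An object $P$ of $\mathfrak{B}$ is $\mathcal{E}_{\mathbb{H}}$-projective if for every $f:X\to Y$ in $\mathcal{E}_{\mathbb{H}}$ every morphism $P\to Y$ factors through $f$. For a functor $\mathbb{T}:\mathfrak{A}\to\mathfrak{B}$, $\mathcal{I}_{\mathbb{T}}$ is the class of morphisms $g$ of $\mathfrak{A}$ such that $\mathbb{T}(g)$ has a retraction (left inverse) in $\mathfrak{B}$. An object $I$ of $\mathfrak{A}$ is $\mathcal{I}_{\mathbb{T}}$-injective if for every $g:X\to Y$ in $\mathcal{I}_{\mathbb{T}}$ every morphism $X\to I$ factors through $g$. Separable functor: a functor $U:\mathfrak{C}\to\mathfrak{D}$ such that the natural transformation $\mathrm{Hom}_{\mathfrak C}(\bullet,\bullet)\to \mathrm{Hom}_{\mathfrak D}(U(\bullet),U(\bullet))$, $f\mapsto U(f)$, of functors $\mathfrak{C}^{op}\times\mathfrak{C}\to\mathfrak{Sets}$ has a left inverse natural transformation. *)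

(* Defs.v *)
From Stdlib Require Import FunctionalExtensionality.

Set Implicit Arguments.
Unset Strict Implicit.

(** Categories with hom-sets in [Type] and Leibniz equality of morphisms. *)

Record category := Category {
  obj :> Type;
  hom : obj -> obj -> Type;
  id : forall X, hom X X;
  comp : forall X Y Z, hom Y Z -> hom X Y -> hom X Z;
  comp_idl : forall X Y (f : hom X Y), comp (id Y) f = f;
  comp_idr : forall X Y (f : hom X Y), comp f (id X) = f;
  compA : forall X Y Z W (h : hom Z W) (g : hom Y Z) (f : hom X Y),
    comp h (comp g f) = comp (comp h g) f
}.

Arguments hom {c} X Y.
Arguments id {c} X.
Arguments comp {c X Y Z} g f.

Declare Scope cat_scope.
Delimit Scope cat_scope with cat.
Local Open Scope cat_scope.
Notation "g \o f" := (comp g f) (at level 50, left associativity) : cat_scope.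

Record functor (C D : category) := Functor {
  fobj :> C -> D;
  fmap : forall X Y : C, hom X Y -> hom (fobj X) (fobj Y);
  fmap_id : forall X, fmap (id X) = id (fobj X);
  fmap_comp : forall (X Y Z : C) (g : hom Y Z) (f : hom X Y),
    fmap (g \o f) = fmap g \o fmap f
}.

Arguments fmap {C D} f0 {X Y} f.

Record nat_trans (C D : category) (F G : functor C D) := NatTrans {
  component :> forall X : C, hom (F X) (G X);
  naturality : forall (X Y : C) (f : hom X Y),
    component Y \o fmap F f = fmap G f \o component X
}.

Definition left_inverse C D (F G : functor C D)
    (psi : nat_trans G F) (phi : nat_trans F G) : Prop :=
  forall X : C, psi X \o phi X = id (F X).

Definition naturally_equivalent C D (F G : functor C D) : Prop :=
  exists (phi : nat_trans F G) (psi : nat_trans G F),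
    left_inverse psi phi /\ left_inverse phi psi.

Definition id_functor (C : category) : functor C C.
Proof. exists (fun X => X) (fun X Y f => f); reflexivity. Defined.

Definition comp_functor C D E (G : functor D E) (F : functor C D) :
  functor C E.
Proof.
exists (fun X => G (F X)) (fun X Y f => fmap G (fmap F f)).
- intros X; rewrite 2!fmap_id; reflexivity.
- intros X Y Z g f; rewrite 2!fmap_comp; reflexivity.
Defined.

Definition op (C : category) : category.
Proof.
exists C (fun X Y => @hom C Y X) (fun X => id X)
  (fun X Y Z g f => comp f g).
- intros; apply comp_idr.
- intros; apply comp_idl.
- intros; symmetry; apply compA.
Defined.

Definition op_functor C D (F : functor C D) : functor (op C) (op D).
Proof.
exists (F : op C -> op D) (fun X Y (f : @hom (op C) X Y) => fmap F f).
- intros X; exact (fmap_id F X).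
- intros X Y Z g f; exact (fmap_comp F f g).
Defined.

Definition prod_cat (C D : category) : category.
Proof.
exists (C * D)%type
  (fun X Y => (hom (fst X) (fst Y) * hom (snd X) (snd Y))%type)
  (fun X => (id (fst X), id (snd X)))
  (fun X Y Z g f => (fst g \o fst f, snd g \o snd f)).
- intros X Y [f1 f2]; cbn; rewrite 2!comp_idl; reflexivity.
- intros X Y [f1 f2]; cbn; rewrite 2!comp_idr; reflexivity.
- intros; cbn; rewrite 2!compA; reflexivity.
Defined.

Definition prod_functor C D C' D' (F : functor C D) (G : functor C' D') :
  functor (prod_cat C C') (prod_cat D D').
Proof.
exists (fun X : prod_cat C C' => (F (fst X), G (snd X)) : prod_cat D D')
  (fun X Y (f : @hom (prod_cat C C') X Y) => (fmap F (fst f), fmap G (snd f))).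
- intros X; cbn; rewrite 2!fmap_id; reflexivity.
- intros X Y Z g f; cbn; rewrite 2!fmap_comp; reflexivity.
Defined.

(** Types play the role of sets. *)
Definition sets : category.
Proof.
exists Type (fun X Y => X -> Y) (fun X x => x) (fun X Y Z g f x => g (f x));
  reflexivity.
Defined.

Definition hom_functor (C : category) : functor (prod_cat (op C) C) sets.
Proof.
exists (fun X : prod_cat (op C) C => @hom C (fst X) (snd X) : sets)
  (fun X Y (f : @hom (prod_cat (op C) C) X Y) (u : @hom C (fst X) (snd X)) =>
     @comp C _ _ _ (snd f) (@comp C _ _ _ u (fst f))).
- intros X; apply functional_extensionality; intros u; cbn.
  rewrite comp_idl, comp_idr; reflexivity.
- intros X Y Z g f; apply functional_extensionality; intros u; cbn.
  rewrite !compA; reflexivity.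
Defined.

(** [Hom_B (T -, -)] and [Hom_A (-, H -)] are naturally equivalent as functors
    from [op A * B] to sets. *)
Definition left_adjoint A B (T : functor A B) (H : functor B A) : Prop :=
  naturally_equivalent
    (comp_functor (hom_functor B) (prod_functor (op_functor T) (id_functor B)))
    (comp_functor (hom_functor A) (prod_functor (id_functor (op A)) H)).

Definition hom_map C D (U : functor C D) :
  nat_trans (hom_functor C)
    (comp_functor (hom_functor D) (prod_functor (op_functor U) U)).
Proof.
exists (fun (X : prod_cat (op C) C) (f : @hom C (fst X) (snd X)) => fmap U f).
intros X Y f; apply functional_extensionality; intros u; cbn.
rewrite 2!fmap_comp; reflexivity.
Defined.

Definition separable C D (U : functor C D) : Prop :=
  exists psi : nat_trans _ _, left_inverse psi (hom_map U).

Definition morphism_class (C : category) :=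
  forall X Y : C, hom X Y -> Prop.

Definition has_section (C : category) (X Y : C) (f : hom X Y) : Prop :=
  exists s : hom Y X, f \o s = id Y.

Definition has_retraction (C : category) (X Y : C) (f : hom X Y) : Prop :=
  exists r : hom Y X, r \o f = id X.

Definition E_class A B (H : functor B A) : morphism_class B :=
  fun X Y f => has_section (fmap H f).

Definition I_class A B (T : functor A B) : morphism_class A :=
  fun X Y g => has_retraction (fmap T g).

Definition projective (C : category) (E : morphism_class C) (P : C) : Prop :=
  forall (X Y : C) (f : hom X Y), E X Y f ->
  forall u : hom P Y, exists v : hom P X, u = f \o v.

Definition injective (C : category) (J : morphism_class C) (I : C) : Prop :=
  forall (X Y : C) (g : hom X Y), J X Y g ->
  forall u : hom X I, exists v : hom Y I, u = v \o g.

(* Main.v *)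
(** An object [P] is [E_H]-projective iff it is a retract of [T (H P)]: the
    counit at [P] lies in [E_H], every [T X] is [E_H]-projective, and
    projectives are stable under retracts.  Since [F (T (H P))] is isomorphic
    to [T' (F' (H P))], applying [F] to such a retraction proves the direct
    implication.  For the converse, [F'H ~ H'F] shows that [F] maps [E_H] into
    [E_H'], and the natural left inverse of [f |-> F f] pulls a factorization of
    [F u] through [F f] back to one of [u] through [f].  Part (a^op) is part (a)
    for the opposite categories, where [op H] is left adjoint to [op T]. *)

From Stdlib Require Import FunctionalExtensionality.
Require Import Defs.

Set Implicit Arguments.
Unset Strict Implicit.

Local Open Scope cat_scope.

Definition retract (C : category) (X Y : C) : Prop :=
  exists (s : hom X Y) (r : hom Y X), r \o s = id X.

Lemma retract_trans (C : category) (X Y Z : C) :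
  retract X Y -> retract Y Z -> retract X Z.
Proof.
intros [s [r rs]] [s' [r' rs']]; exists (s' \o s), (r \o r').
rewrite compA, <- (compA r r' s'), rs', comp_idr; exact rs.
Qed.

Lemma retract_fmap (C D : category) (F : functor C D) (X Y : C) :
  retract X Y -> retract (F X) (F Y).
Proof.
intros [s [r rs]]; exists (fmap F s), (fmap F r).
rewrite <- fmap_comp, rs; apply fmap_id.
Qed.

Lemma projective_retract (C : category) (E : morphism_class C) (P Q : C) :
  retract P Q -> projective E Q -> projective E P.
Proof.
intros [s [r rs]] projQ X Y f Ef u.
destruct (projQ X Y f Ef (u \o r)) as [v Ev].
exists (v \o s); rewrite compA, <- Ev, <- compA, rs, comp_idr; reflexivity.
Qed.

Lemma naturally_equivalent_sym (C D : category) (F G : functor C D) :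
  naturally_equivalent F G -> naturally_equivalent G F.
Proof. intros [phi [psi [H1 H2]]]; exists psi, phi; split; assumption. Qed.

Lemma naturally_equivalent_retract (C D : category) (F G : functor C D) (X : C) :
  naturally_equivalent F G -> retract (F X) (G X).
Proof. intros [phi [psi [psiK _]]]; exists (phi X), (psi X); apply psiK. Qed.

Lemma has_section_fmap (C D : category) (F : functor C D) (X Y : C)
    (f : hom X Y) : has_section f -> has_section (fmap F f).
Proof.
intros [s fs]; exists (fmap F s).
rewrite <- fmap_comp, fs; apply fmap_id.
Qed.

Lemma has_section_naturally_equivalent (C D : category) (F G : functor C D)
    (X Y : C) (f : hom X Y) :
  naturally_equivalent F G -> has_section (fmap F f) -> has_section (fmap G f).
Proof.
(* The section [s] is conjugated by the equivalence; naturality of [phi] moves [fmap G f] past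
   [phi X]. *)
intros [phi [psi [_ phiK]]] [s fs]; exists (phi X \o s \o psi Y).
rewrite 2!compA, <- naturality, <- (compA (phi Y)), fs, comp_idr.
apply phiK.
Qed.

(** The equivalence of hom-functors is evaluated at pairs [(X, Y)]; naturality in [Y] is its
    naturality square at [(id X, g)]. *)
Lemma left_adjoint_transpose (A B : category) (T : functor A B)
    (H : functor B A) :
  left_adjoint T H ->
  exists (phi : forall (X : A) (Y : B), hom (T X) Y -> hom X (H Y))
         (psi : forall (X : A) (Y : B), hom X (H Y) -> hom (T X) Y),
    (forall X Y u, psi X Y (phi X Y u) = u) /\
    (forall X Y v, phi X Y (psi X Y v) = v) /\
    (forall X Y Z (g : hom Y Z) u,
       phi X Z (g \o u) = fmap H g \o phi X Y u).
Proof.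
intros [phi [psi [psiK phiK]]].
exists (fun X Y => phi (X, Y)), (fun X Y => psi (X, Y)).
split; [|split].
- intros X Y u; exact (equal_f (psiK (X, Y)) u).
- intros X Y v; exact (equal_f (phiK (X, Y)) v).
- intros X Y Z g u.
  pose proof (equal_f (@naturality _ _ _ _ phi (X, Y) (X, Z) (id X, g)) u) as E.
  cbn in E; rewrite fmap_id, 2!comp_idr in E; exact E.
Qed.

Lemma projective_left_adjoint (A B : category) (T : functor A B)
    (H : functor B A) (X : A) :
  left_adjoint T H -> projective (E_class H) (T X).
Proof.
intros adj; destruct (left_adjoint_transpose adj)
  as [phi [psi [psiK [phiK phi_nat]]]].
(* Transpose [u], lift it along the section [s] of [fmap H f], and transpose back. *)
intros Y Z f [s fs] u; exists (psi X Y (s \o phi X Z u)).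
rewrite <- (psiK _ _ (f \o _)), phi_nat, phiK, compA, fs, comp_idl, psiK.
reflexivity.
Qed.

Lemma projective_retract_counit (A B : category) (T : functor A B)
    (H : functor B A) (P : B) :
  left_adjoint T H -> projective (E_class H) P -> retract P (T (H P)).
Proof.
intros adj; destruct (left_adjoint_transpose adj)
  as [phi [psi [_ [phiK phi_nat]]]].
intros projP.
(* [psi (H P) P (id (H P))] is the counit at [P]; a factorization of [id P] through it is the
   desired retraction. *)
destruct (projP _ _ (psi (H P) P (id (H P)))) with (u := id P) as [s Es].
(* By a triangle identity, the unit at [H P] is a section of the image of the counit under [H]. *)
- exists (phi (H P) (T (H P)) (id (T (H P)))).
  rewrite <- phi_nat, comp_idr; apply phiK.
- exists s, (psi (H P) P (id (H P))); symmetry; exact Es.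
Qed.

Lemma projective_image (A B A' B' : category)
    (T : functor A B) (H : functor B A)
    (T' : functor A' B') (H' : functor B' A')
    (F' : functor A A') (F : functor B B') (P : B) :
  left_adjoint T H -> left_adjoint T' H' ->
  naturally_equivalent (comp_functor T' F') (comp_functor F T) ->
  projective (E_class H) P -> projective (E_class H') (F P).
Proof.
intros adj adj' eqT projP.
apply projective_retract with (Q := T' (F' (H P))).
- apply retract_trans with (Y := F (T (H P))).
  + apply retract_fmap, projective_retract_counit; assumption.
  + exact (naturally_equivalent_retract (H P) (naturally_equivalent_sym eqT)).
- apply projective_left_adjoint; exact adj'.
Qed.

Lemma E_class_image (A B A' B' : category)
    (H : functor B A) (H' : functor B' A')
    (F' : functor A A') (F : functor B B') (X Y : B) (f : hom X Y) :
  naturally_equivalent (comp_functor F' H) (comp_functor H' F) ->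
  E_class H f -> E_class H' (fmap F f).
Proof.
intros eqH Ef; apply (has_section_naturally_equivalent eqH).
exact (has_section_fmap F' Ef).
Qed.

Lemma projective_reflect (A B A' B' : category)
    (H : functor B A) (H' : functor B' A')
    (F' : functor A A') (F : functor B B') (P : B) :
  naturally_equivalent (comp_functor F' H) (comp_functor H' F) ->
  separable F -> projective (E_class H') (F P) -> projective (E_class H) P.
Proof.
intros eqH [psi psiK] projFP X Y f Ef u.
destruct (projFP _ _ _ (E_class_image eqH Ef) (fmap F u)) as [v Ev].
(* Naturality of [psi] at [(id P, f)] gives [f \o psi (P, X) v = psi (P, Y) (fmap F f \o v)], which
   is [psi (P, Y) (fmap F u) = u]. *)
exists (psi (P, X) v).
pose proof (equal_f (@naturality _ _ _ _ psi (P, X) (P, Y) (id P, f)) v) as E.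
cbn in E; rewrite fmap_id, 2!comp_idr, <- Ev in E; rewrite <- E.
symmetry; exact (equal_f (psiK (P, Y)) u).
Qed.

(** Passing to opposites swaps the two arguments of each hom-functor, so the same bijections serve,
    with [phi] and [psi] exchanged. *)
Lemma left_adjoint_op (A B : category) (T : functor A B) (H : functor B A) :
  left_adjoint T H -> left_adjoint (op_functor H) (op_functor T).
Proof.
intros [phi [psi [psiK phiK]]].
unshelve eexists; [|unshelve eexists; [|split]].
- exists (fun X => psi (snd X, fst X)).
  intros X Y f; apply functional_extensionality; intros u.
  pose proof (equal_f (@naturality _ _ _ _ psi (snd X, fst X) (snd Y, fst Y)
    (snd f, fst f)) u) as E.
  (* Reversing composition flips the bracketing of threefold composites, hence [compA] on both
     sides. *)
  cbn in *; rewrite compA in E; rewrite E; apply compA.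
- exists (fun X => phi (snd X, fst X)).
  intros X Y f; apply functional_extensionality; intros u.
  pose proof (equal_f (@naturality _ _ _ _ phi (snd X, fst X) (snd Y, fst Y)
    (snd f, fst f)) u) as E.
  cbn in *; rewrite compA in E; rewrite E; apply compA.
- intros X; exact (phiK (snd X, fst X)).
- intros X; exact (psiK (snd X, fst X)).
Qed.

Lemma separable_op (C D : category) (U : functor C D) :
  separable U -> separable (op_functor U).
Proof.
intros [psi psiK]; unshelve eexists.
- exists (fun X => psi (snd X, fst X)).
  intros X Y f; apply functional_extensionality; intros u.
  pose proof (equal_f (@naturality _ _ _ _ psi (snd X, fst X) (snd Y, fst Y)
    (snd f, fst f)) u) as E.
  cbn in *; rewrite compA in E; rewrite E; apply compA.
- intros X; exact (psiK (snd X, fst X)).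
Qed.

(* [op_functor (comp_functor G F)] and [comp_functor (op_functor G) (op_functor F)]
   agree only up to their proof fields, so composites are dualized directly. *)
Lemma naturally_equivalent_comp_op (C D D' E : category)
    (G : functor D E) (F : functor C D)
    (G' : functor D' E) (F' : functor C D') :
  naturally_equivalent (comp_functor G F) (comp_functor G' F') ->
  naturally_equivalent (comp_functor (op_functor G') (op_functor F'))
                       (comp_functor (op_functor G) (op_functor F)).
Proof.
intros [phi [psi [psiK phiK]]].
unshelve eexists; [|unshelve eexists; [|split]].
- exists (fun X : op C => phi X : @hom (op E) (G' (F' X)) (G (F X))).
  intros X Y f; symmetry; exact (naturality phi f).
- exists (fun X : op C => psi X : @hom (op E) (G (F X)) (G' (F' X))).
  intros X Y f; symmetry; exact (naturality psi f).
- exact phiK.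
- exact psiK.
Qed.

Theorem theorem1p13 (A B A' B' : category)
    (T : functor A B) (H : functor B A)
    (T' : functor A' B') (H' : functor B' A')
    (adjTH : left_adjoint T H) (adjTH' : left_adjoint T' H')
    (F' : functor A A') (F : functor B B')
    (eqT : naturally_equivalent (comp_functor T' F') (comp_functor F T))
    (eqH : naturally_equivalent (comp_functor F' H) (comp_functor H' F))
    (P : B) (I : A) :
  ((projective (E_class H) P -> projective (E_class H') (F P)) /\
   (separable F ->
      projective (E_class H') (F P) -> projective (E_class H) P)) /\
  ((injective (I_class T) I -> injective (I_class T') (F' I)) /\
   (separable F' ->
      injective (I_class T') (F' I) -> injective (I_class T) I)).
Proof.
(* Dually [op_functor H] is the left adjoint, so [eqH_op] takes the place of [eqT] and [eqT_op] that
   of [eqH]. *)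
assert (eqT_op := naturally_equivalent_comp_op eqT).
assert (eqH_op := naturally_equivalent_comp_op eqH).
split; split.
- exact (projective_image (P := P) adjTH adjTH' eqT).
- exact (projective_reflect (P := P) eqH).
(* Injectivity in [A] is, by conversion, projectivity in [op A] with source and target of [g]
   exchanged. *)
- intros injI X Y g.
  exact (projective_image (P := I : op A) (left_adjoint_op adjTH)
    (left_adjoint_op adjTH') eqH_op (fun X Y g => injI Y X g) (X := Y) (Y := X)
    (f := g)).
- intros sepF' injFI X Y g.
  exact (projective_reflect (P := I : op A) eqT_op (separable_op sepF')
    (fun X Y g => injFI Y X g) (X := Y) (Y := X) (f := g)).
Qed.
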